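(* Let $\rho:[0,\infty)\to(0,\infty)$ be an arbitrary positive function with $\rho(x)\to 0$ as $x\to\infty$. Then there exists $\tau\in V_{-\infty}$ such that $$\limsup_{x\to\infty}\frac{|\tau(x)|}{\rho(x)}=\infty.$$
   Context: $V_{-\infty}$ is the space of all (complex-valued) continuously differentiable functions $\tau\in C^1[0,\infty)$ such that $\tau'(x)\to0$ as $x\to\infty$ and such that the Laplace transform $\mathcal{L}\{\tau;s\}=\int_0^\infty\tau(x)e^{-sx}\,dx$ (which converges for $\operatorname{Re}s>0$) admits an extension to $\mathbb{C}$ as an entire function. *)

(* Defs.v *)
From Stdlib Require Import Reals.
From Coquelicot Require Import Coquelicot.
Open Scope R_scope.

(* Not in Coquelicot's Complex. *)
Definition Cexp (z : C) : C :=
  (exp (Re z) * cos (Im z), exp (Re z) * sin (Im z)).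

(* Neighbourhoods of [x] relative to [0,oo): a one-sided filter at [x = 0]. *)
Definition locally_nonneg (x : R) : (R -> Prop) -> Prop :=
  within (fun y : R => 0 <= y) (locally x).

(* [dtau] is the derivative on [0,oo), one-sided at 0; functions on [0,oo) are
   total functions on [R] whose values on negative arguments play no role. *)
Definition is_deriv_nonneg (tau dtau : R -> C) : Prop :=
  forall x : R, 0 <= x ->
    @filterdiff R_AbsRing R_NormedModule C_R_NormedModule
      tau (locally_nonneg x) (fun h : R => scal h (dtau x)).

Definition continuous_nonneg (f : R -> C) : Prop :=
  forall x : R, 0 <= x -> filterlim f (locally_nonneg x) (locally (f x)).

Definition is_Laplace (tau : R -> C) (s l : C) : Prop :=
  @is_RInt_gen C_R_NormedModule
    (fun x : R => Cmult (tau x) (Cexp (Copp (Cmult s (RtoC x)))))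
    (at_point 0) (Rbar_locally p_infty) l.

Definition entire (F : C -> C) : Prop :=
  forall z : C, @ex_derive C_AbsRing C_NormedModule F z.

Definition V_minus_infty (tau : R -> C) : Prop :=
  (exists dtau : R -> C,
     is_deriv_nonneg tau dtau /\
     continuous_nonneg dtau /\
     filterlim dtau (Rbar_locally p_infty) (locally (RtoC 0))) /\
  (exists F : C -> C,
     entire F /\
     forall s : C, 0 < Re s -> is_Laplace tau s (F s)).

(* limsup_{x -> oo} g(x) = inf_{X >= 0} sup_{x >= X} g(x), in the extended reals. *)
Definition LimSup_infty (g : R -> R) : Rbar :=
  Rbar_glb (fun L : Rbar => exists X : R, 0 <= X /\
    L = Lub_Rbar (fun y : R => exists x : R, X <= x /\ y = g x)).

(* Main.v *)
(* The function tau is a sum of bumps a_n w_n with disjoint supports [2 pi k, 4 pi k], where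
   k = k_n is sparse, a_n = (n + 2)^-2 and w_n(x) = sin(x/2k)^k exp(i (n + 1/2) x).  Since
   |w_n| <= 1 and |w_n'| <= n + 2, tau is C^1 with tau' -> 0, while |tau(3 pi k_n)| = a_n, and
   k_n can be chosen so large that rho(3 pi k_n) < a_n / (n + 1).
   Put f_j(x) = sin(x/2k)^j exp(i (n + j/2k) x).  Then f_j' = (j/2k) f_{j-1} + i (n + j/k) f_j,
   so the Laplace transforms I_j of f_j over the support satisfy
   (s - i (n + j/k)) I_j(s) = (j/2k) I_{j-1}(s) for j >= 1.  Iterating k times, I_k = O((n - r)^-k)
   relative to I_0 on |s| <= r, which beats the trivial bound exp(4 pi (r + 4) k) of I_0 as soon
   as n is large.  Hence the transforms of the bumps sum to an entire function. *)
Require Import Defs.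
From Stdlib Require Import Reals ZArith Lra Lia IndefiniteDescription Classical.
From Coquelicot Require Import Coquelicot.
Open Scope R_scope.

(** Put [y = x/2k] and [u = exp(iy) sin y = (exp(2iy) - 1)/2i]. Then [f_j = exp(inx) u^j], and
    [du/dy = 1 + 2iu] is affine in [u]: this is why the phase [j/2k] accompanies the power [j], and
    why the derivative of [f_j] involves only [f_{j-1}] and [f_j]. The decisive point is that
    nothing bounds [k] from above. Each step of the recursion has a coefficient [j/2k <= 1/2],
    whatever [k] is, and the [k] steps together gain [(n - r)^-k]. The support has length
    proportional to [k], which costs a factor exponential in [k]. The quotient is the [k]-th power
    of a quantity that depends on [n] and [r] only and tends to 0 with [n], so taking [k_n] larger
    never harms convergence. Hence the amplitudes can be fixed in advance and [rho], however slowly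
    it decays, enters only through the choice of [k_n]. The frequencies have to grow so that the
    points [i (n + j/k)] leave every disc; the amplitudes decay fast enough to keep this growth out
    of the derivative of [tau]. *)

(* [ring] needs the equality to be at type [C] syntactically, not at one of the
   structures of [C]. *)
Ltac Ceq := match goal with |- ?l = ?r => change (@eq C l r) end.

(** * The complex exponential; derivatives and integrals of functions from [R] to [C] *)

Lemma norm_Cmod (z : C) : @norm R_AbsRing C_R_NormedModule z = Cmod z.
Proof. now rewrite Cmod_norm. Qed.

Lemma Cexp_plus (w z : C) : Cexp (w + z) = (Cexp w * Cexp z)%C.
Proof.
  unfold Cexp; destruct w as [a b], z as [c d]; unfold Cmult; simpl.
  rewrite exp_plus, cos_plus, sin_plus; f_equal; ring.
Qed.

Lemma Cexp_0 : Cexp 0 = 1%C.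
Proof. unfold Cexp; simpl. rewrite exp_0, cos_0, sin_0. unfold RtoC; f_equal; ring. Qed.

Lemma Cmod_Cexp (z : C) : Cmod (Cexp z) = exp (Re z).
Proof.
  unfold Cexp, Cmod; simpl.
  replace (_ + _) with (exp (Re z) * exp (Re z) * (Rsqr (sin (Im z)) + Rsqr (cos (Im z))))
    by (unfold Rsqr; ring).
  rewrite sin2_cos2, Rmult_1_r. apply sqrt_square, Rlt_le, exp_pos.
Qed.

Lemma Cmod_Cexp_le (z : C) : Cmod (Cexp z) <= exp (Cmod z).
Proof.
  rewrite Cmod_Cexp. generalize (re_le_Cmod z) (Rle_abs (Re z)); intros H1 H2.
  destruct (Rle_lt_or_eq_dec (Re z) (Cmod z)) as [H|H]; [lra|left; now apply exp_increasing|rewrite H; lra].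
Qed.

Lemma exp_le (x y : R) : x <= y -> exp x <= exp y.
Proof.
  intros H. destruct (Rle_lt_or_eq_dec _ _ H) as [H'|H'];
    [left; now apply exp_increasing|rewrite H'; lra].
Qed.

Lemma is_derive_pair (f : R -> C) (x : R) (l : C) :
  is_derive (fun t => fst (f t)) x (fst l) ->
  is_derive (fun t => snd (f t)) x (snd l) ->
  @is_derive R_AbsRing C_R_NormedModule f x l.
Proof.
  intros H1 H2.
  assert (H := @is_derive_plus R_AbsRing C_R_NormedModule _ _ x _ _
    (@is_derive_scal_l R_AbsRing C_R_NormedModule _ x _ (RtoC 1) H1)
    (@is_derive_scal_l R_AbsRing C_R_NormedModule _ x _ Ci H2)).
  assert (E : forall u v : R, @plus C_R_NormedModule
     (@scal R_AbsRing C_R_NormedModule u (RtoC 1)) (@scal R_AbsRing C_R_NormedModule v Ci) = (u, v)).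
  { intros u v. unfold plus, scal; simpl; unfold prod_plus, prod_scal, scal, plus, mult; simpl;
    unfold mult; simpl. f_equal; ring. }
  destruct l as [l1 l2]. simpl fst in H; simpl snd in H. rewrite <- (E l1 l2).
  refine (is_derive_ext _ _ _ _ (fun t => _) H). etransitivity; [apply E|now destruct (f t)].
Qed.

Lemma continuous_pair (f : R -> C) (x : R) :
  continuous (fun t => fst (f t)) x -> continuous (fun t => snd (f t)) x ->
  continuous f x.
Proof.
  intros H1 H2. apply filterlim_locally. intros eps.
  generalize (proj1 (filterlim_locally _ _) H1 eps) (proj1 (filterlim_locally _ _) H2 eps).
  intros K1 K2. generalize (filter_and _ _ K1 K2). apply filter_imp. intros t [A B]. now split.
Qed.

Lemma continuous_Re (f : R -> C) (x : R) : continuous f x -> continuous (fun t => fst (f t)) x.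
Proof. intros H. apply (continuous_comp f fst); auto. destruct (f x); apply continuous_fst. Qed.
Lemma continuous_Im (f : R -> C) (x : R) : continuous f x -> continuous (fun t => snd (f t)) x.
Proof. intros H. apply (continuous_comp f snd); auto. destruct (f x); apply continuous_snd. Qed.

Lemma continuous_Cmult (f g : R -> C) (x : R) :
  continuous f x -> continuous g x -> continuous (fun t => Cmult (f t) (g t)) x.
Proof.
  intros Hf Hg.
  assert (f1 := continuous_Re _ _ Hf); assert (f2 := continuous_Im _ _ Hf);
  assert (g1 := continuous_Re _ _ Hg); assert (g2 := continuous_Im _ _ Hg).
  apply continuous_pair; simpl;
  [apply (continuous_minus (V:=R_NormedModule))|apply (continuous_plus (V:=R_NormedModule))];
  now apply (continuous_mult (K:=R_AbsRing)).
Qed.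

Lemma is_derive_Cexp (z : C) (x : R) :
  @is_derive R_AbsRing C_R_NormedModule (fun t : R => Cexp (z * t)) x (z * Cexp (z * x))%C.
Proof. destruct z as [a b]. apply is_derive_pair; simpl; auto_derive; auto; unfold Rminus; ring. Qed.

Lemma continuous_Cexp (z : C) (x : R) : continuous (fun t : R => Cexp (z * t)) x.
Proof. apply (@ex_derive_continuous R_AbsRing C_R_NormedModule). eexists; apply is_derive_Cexp. Qed.

Lemma continuous_RtoC (p : R -> R) (x : R) :
  continuous p x -> continuous (fun t => RtoC (p t)) x.
Proof. intros H; apply continuous_pair; simpl; auto. apply continuous_const. Qed.

Definition CInt (f : R -> C) (a b : R) : C := @RInt C_R_CompleteNormedModule f a b.

Lemma CInt_correct (f : R -> C) (a b : R) :
  (forall x, continuous f x) -> @is_RInt C_R_NormedModule f a b (CInt f a b).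
Proof.
  intros H. apply (@RInt_correct C_R_CompleteNormedModule).
  apply (@ex_RInt_continuous C_R_CompleteNormedModule). intros; apply H.
Qed.

Lemma CInt_unique (f : R -> C) (a b : R) (l : C) :
  @is_RInt C_R_NormedModule f a b l -> CInt f a b = l.
Proof. apply (@is_RInt_unique C_R_CompleteNormedModule). Qed.

Lemma is_RInt_Cmult (f : R -> C) (a b : R) (c l : C) :
  @is_RInt C_R_NormedModule f a b l ->
  @is_RInt C_R_NormedModule (fun x => Cmult c (f x)) a b (Cmult c l).
Proof.
  intros H. assert (H1 := is_RInt_fct_extend_fst _ _ _ _ H).
  assert (H2 := is_RInt_fct_extend_snd _ _ _ _ H).
  apply (@is_RInt_fct_extend_pair R_NormedModule R_NormedModule); simpl.
  - exact (is_RInt_minus _ _ _ _ _ _ (is_RInt_scal _ _ _ (fst c) _ H1) (is_RInt_scal _ _ _ (snd c) _ H2)).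
  - exact (is_RInt_plus _ _ _ _ _ _ (is_RInt_scal _ _ _ (fst c) _ H2) (is_RInt_scal _ _ _ (snd c) _ H1)).
Qed.

Lemma Cmod_RInt_le (f : R -> C) (g : R -> R) (a b : R) (l : C) (m : R) :
  a <= b -> (forall x, a <= x <= b -> Cmod (f x) <= g x) ->
  @is_RInt C_R_NormedModule f a b l -> is_RInt g a b m -> Cmod l <= m.
Proof.
  intros Hab H Hf Hg. rewrite <- norm_Cmod.
  apply (@norm_RInt_le C_R_NormedModule f g a b); auto.
  intros x Hx. rewrite norm_Cmod; auto.
Qed.

Lemma Cmod_RInt_le_const (f : R -> C) (a b : R) (l : C) (M : R) :
  a <= b -> (forall x, a <= x <= b -> Cmod (f x) <= M) ->
  @is_RInt C_R_NormedModule f a b l -> Cmod l <= (b - a) * M.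
Proof.
  intros Hab H Hf. apply (Cmod_RInt_le f (fun _ => M) a b); auto.
  apply (@is_RInt_const R_NormedModule).
Qed.

Lemma Cmod_Cexp_scal (z : C) (t : R) : 0 <= t <= 1 -> Cmod (Cexp (z * t)) <= exp (Cmod z).
Proof.
  intros Ht. apply Rle_trans with (1 := Cmod_Cexp_le _). apply exp_le.
  rewrite Cmod_mult, Cmod_R, Rabs_pos_eq by lra.
  rewrite <- Rmult_1_r. apply Rmult_le_compat_l; [apply Cmod_ge_0|lra].
Qed.

(** The left side is the integral of [z exp(zt)] over [0, 1], whose integrand is at most
    [|z| exp |z|]. *)
Lemma Cmod_Cexp_minus_1 (z : C) : Cmod (Cexp z - 1) <= Cmod z * exp (Cmod z).
Proof.
  assert (H := @is_RInt_derive C_R_CompleteNormedModule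
    (fun t : R => Cexp (z * t)) (fun t : R => Cmult z (Cexp (z * t))) 0 1
    (fun x _ => is_derive_Cexp z x)
    (fun x _ => continuous_Cmult _ _ _ (continuous_const _ _) (continuous_Cexp z x))).
  assert (K := fun X => Cmod_RInt_le_const _ 0 1 _ (Cmod z * exp (Cmod z)) Rle_0_1 X H).
  rewrite Rminus_0_r, Rmult_1_l in K.
  replace (Cexp z - 1)%C with
    (@minus C_R_CompleteNormedModule (Cexp (z * 1)%C) (Cexp (z * 0)%C)).
  2:{ change (@minus C_R_CompleteNormedModule) with Cminus.
      now rewrite Cmult_1_r, Cmult_0_r, Cexp_0. }
  apply K.
  intros x Hx. rewrite Cmod_mult. apply Rmult_le_compat_l; [apply Cmod_ge_0|now apply Cmod_Cexp_scal].
Qed.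

(** One integration further: [exp(zt) - zt] has derivative [z (exp(zt) - 1)], which
    [Cmod_Cexp_minus_1] controls. *)
Lemma Cmod_Cexp_minus_1_minus (z : C) : Cmod (Cexp z - 1 - z) <= Cmod z ^ 2 * exp (Cmod z).
Proof.
  assert (D : forall x : R, @is_derive R_AbsRing C_R_NormedModule
     (fun t : R => (Cexp (z * t) - z * t)%C) x (z * (Cexp (z * x) - 1))%C).
  { intros x. destruct z as [a b]. apply is_derive_pair; simpl; auto_derive; auto; unfold Rminus; ring. }
  assert (H := @is_RInt_derive C_R_CompleteNormedModule _ _ 0 1 (fun x _ => D x)).
  assert (K := fun X Y => Cmod_RInt_le_const _ 0 1 _ (Cmod z ^ 2 * exp (Cmod z)) Rle_0_1 X (H Y)).
  rewrite Rminus_0_r, Rmult_1_l in K.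
  replace (Cexp z - 1 - z)%C with
    (@minus C_R_CompleteNormedModule (Cexp (z * 1) - z * 1)%C (Cexp (z * 0) - z * 0)%C).
  2:{ change (@minus C_R_CompleteNormedModule) with Cminus.
      rewrite Cmult_1_r, Cmult_0_r, Cexp_0.
      Ceq; ring. }
  apply K; clear.
  - intros x Hx. rewrite Cmod_mult. simpl (_ ^ 2). rewrite Rmult_1_r, Rmult_assoc.
    apply Rmult_le_compat_l; [apply Cmod_ge_0|].
    apply Rle_trans with (1 := Cmod_Cexp_minus_1 _).
    assert (L : Cmod (z * x) <= Cmod z).
    { rewrite Cmod_mult, Cmod_R, Rabs_pos_eq by lra.
      rewrite <- Rmult_1_r. apply Rmult_le_compat_l; [apply Cmod_ge_0|lra]. }
    apply Rmult_le_compat; auto using Cmod_ge_0, exp_le. left; apply exp_pos.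
  - intros x _. apply continuous_Cmult; [apply continuous_const|].
    apply (@continuous_minus _ R_AbsRing C_R_NormedModule);
      [apply continuous_Cexp|apply continuous_const].
Qed.

(** * Laplace transforms over a finite interval and their second order bounds *)

Definition Lap (f : R -> C) (a b : R) (s : C) : C :=
  CInt (fun x => f x * Cexp (- (s * x)))%C a b.

(* In place of Cauchy's estimates, explicit second order bounds justify differentiating
   a series of entire functions term by term. *)
Definition taylor_bound (r M : R) (G dG : C -> C) : Prop :=
  forall s h : C, Cmod s <= r -> Cmod (s + h) <= r -> Cmod h <= 1 ->
    Cmod (G s) <= M /\ Cmod (dG s) <= M /\
    Cmod (G (s + h) - G s)%C <= M * Cmod h /\
    Cmod (G (s + h) - G s - h * dG s)%C <= M * Cmod h ^ 2.

Lemma continuous_Cexp_opp (s : C) (x : R) : continuous (fun t : R => Cexp (- (s * t))) x.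
Proof.
  apply (continuous_ext (fun t : R => Cexp (- s * t))); [|apply continuous_Cexp].
  intros t; f_equal; ring.
Qed.

Lemma continuous_Lap (f : R -> C) (s : C) :
  (forall x, continuous f x) -> forall x, continuous (fun t : R => f t * Cexp (- (s * t)))%C x.
Proof. intros Hf x. apply continuous_Cmult; [apply Hf|apply continuous_Cexp_opp]. Qed.

(** The factor [-x] is what differentiation in [s] brings down from the kernel [exp(-sx)]; the
    transform of this product is the derivative of the transform of [f]. *)
Lemma continuous_moment (f : R -> C) :
  (forall x, continuous f x) -> forall x, continuous (fun t : R => - t * f t)%C x.
Proof.
  intros Hf x. apply continuous_Cmult; [|apply Hf].
  apply (continuous_ext (fun t : R => RtoC (- t))); [intros t; now rewrite RtoC_opp|].
  apply continuous_RtoC, (@continuous_opp _ R_AbsRing R_NormedModule), continuous_id.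
Qed.

Lemma Lap_correct (f : R -> C) (a b : R) (s : C) :
  (forall x, continuous f x) ->
  @is_RInt C_R_NormedModule (fun x => f x * Cexp (- (s * x)))%C a b (Lap f a b s).
Proof. intros Hf. apply CInt_correct. now apply continuous_Lap. Qed.

(** One estimate serves all four bounds of [taylor_bound], with the weight [w] equal to 1, [-x],
    [exp(-hx) - 1] or [exp(-hx) - 1 + hx]. The kernel contributes at most [exp(rb)]. *)
Lemma Lap_weighted_le (f w : R -> C) (a b r W : R) (s l : C) :
  0 <= a -> a <= b -> (forall x, Cmod (f x) <= 1) -> Cmod s <= r ->
  (forall x, a <= x <= b -> Cmod (w x) <= W) ->
  @is_RInt C_R_NormedModule (fun x => w x * (f x * Cexp (- (s * x))))%C a b l ->
  Cmod l <= (b - a) * (W * exp (r * b)).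
Proof.
  intros Ha Hab Hf Hs Hw. apply Cmod_RInt_le_const; auto.
  intros x Hx. rewrite 2!Cmod_mult. apply Rmult_le_compat; auto using Cmod_ge_0.
  - apply Rmult_le_pos; apply Cmod_ge_0.
  - rewrite <- (Rmult_1_l (exp _)).
    apply Rmult_le_compat; auto using Cmod_ge_0.
    apply Rle_trans with (1 := Cmod_Cexp_le _). apply exp_le.
    rewrite Cmod_opp, Cmod_mult, Cmod_R, Rabs_pos_eq by lra.
    apply Rmult_le_compat; auto using Cmod_ge_0; lra.
Qed.

Lemma le_exp (x : R) : x <= exp x.
Proof. generalize (exp_ineq1_le x); lra. Qed.

(** In the exponent, [rb] comes from the kernel. Of the remaining [4b], one [b] absorbs the length
    [b - a] and three absorb the weight, which for the second order remainder is [b^2 exp b] times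
    [|h|^2]; the factor [exp b] there bounds [exp |hx|] for [|h| <= 1]. *)
Lemma Lap_taylor_bound (f : R -> C) (a b r : R) :
  0 <= a -> a <= b -> (forall x, continuous f x) -> (forall x, Cmod (f x) <= 1) ->
  taylor_bound r (exp ((r + 4) * b)) (Lap f a b) (Lap (fun x => - x * f x)%C a b).
Proof.
  intros Ha Hab Hf Bf s h Hs Hsh Hh.
  assert (I0 := Lap_correct f a b s Hf).
  assert (I1 := Lap_correct _ a b s (continuous_moment f Hf)).
  assert (I2 := Lap_correct f a b (s + h) Hf).
  set (L := Lap f a b) in *. set (dL := Lap (fun x => - x * f x)%C a b) in *.
  assert (E1 : 1 <= exp b) by (generalize (exp_ineq1_le b); lra).
  assert (Eb := le_exp b).
  assert (B : forall W, 0 <= W <= b * b * exp b \/ 0 <= W <= 1 \/ 0 <= W <= b * exp b \/ 0 <= W <= b ->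
     (b - a) * (W * exp (r * b)) <= exp ((r + 4) * b)).
  { intros W HW. replace ((r + 4) * b) with (b + (b + b + b) + r * b) by ring.
    rewrite 4!exp_plus. rewrite <- Rmult_assoc.
    apply Rmult_le_compat_r; [left; apply exp_pos|].
    assert (0 <= W <= exp b * exp b * exp b).
    { assert (b <= exp b * exp b) by nra. assert (b * b <= exp b * exp b) by nra.
      assert (1 <= exp b * exp b) by nra.
      destruct HW as [[W0 W1]|[[W0 W1]|[[W0 W1]|[W0 W1]]]]; split; nra. }
    apply Rmult_le_compat; lra. }
  assert (Hx : forall x : R, a <= x <= b -> Cmod (- (h * x))%C <= Cmod h * b /\ Cmod (- (h * x))%C <= b).
  { intros x Hx. rewrite Cmod_opp, Cmod_mult, Cmod_R, Rabs_pos_eq by lra.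
    generalize (Cmod_ge_0 h). intros. split; nra. }
  assert (Eh : forall x : R, Cexp (- ((s + h) * x)) = (Cexp (- (s * x)) * Cexp (- (h * x)))%C).
  { intros x. rewrite <- Cexp_plus. f_equal; ring. }
  assert (D := @is_RInt_minus C_R_NormedModule _ _ _ _ _ _ I2 I0).
  assert (h0 := Cmod_ge_0 h).
  repeat split.
  - eapply Rle_trans; [|apply (B 1); lra].
    apply (Lap_weighted_le f (fun _ => RtoC 1) a b r 1 s); auto; [intros; rewrite Cmod_1; lra|].
    eapply is_RInt_ext; [|exact I0]. intros x _; simpl. now rewrite Cmult_1_l.
  - eapply Rle_trans; [|apply (B b); lra].
    apply (Lap_weighted_le f (fun x => - x)%C a b r b s); [exact Ha|exact Hab|exact Bf|exact Hs| |].
    + intros x Hx'. rewrite Cmod_opp, Cmod_R, Rabs_pos_eq; lra.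
    + eapply is_RInt_ext; [|exact I1]. intros x _; simpl. now rewrite Cmult_assoc.
  - eapply Rle_trans with ((b - a) * ((b * exp b * Cmod h) * exp (r * b))).
    2:{ replace (_ * (b * exp b * _ * _)) with (Cmod h * ((b - a) * (b * exp b * exp (r * b)))) by ring.
        rewrite (Rmult_comm _ (Cmod h)). apply Rmult_le_compat_l; auto. apply B. right; right; left; split; nra. }
    apply (Lap_weighted_le f (fun x => Cexp (- (h * x)) - 1)%C a b r _ s); [exact Ha|exact Hab|exact Bf|exact Hs| |].
    + intros x Hx'. destruct (Hx x Hx') as [X1 X2].
      apply Rle_trans with (1 := Cmod_Cexp_minus_1 _).
      replace (b * exp b * Cmod h) with (Cmod h * b * exp b) by ring.
      apply Rmult_le_compat; auto using Cmod_ge_0, exp_le. left; apply exp_pos.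
    + eapply is_RInt_ext; [|exact D]. intros x _. simpl. rewrite Eh.
      change (@minus C_R_NormedModule) with Cminus.
      Ceq; ring.
  - assert (D2 := @is_RInt_minus C_R_NormedModule _ _ _ _ _ _ D (is_RInt_Cmult _ _ _ h _ I1)).
    eapply Rle_trans with ((b - a) * ((b * b * exp b * Cmod h ^ 2) * exp (r * b))).
    2:{ replace (_ * (b * b * exp b * _ * _))
          with (Cmod h ^ 2 * ((b - a) * (b * b * exp b * exp (r * b)))) by ring.
        rewrite (Rmult_comm _ (Cmod h ^ 2)). apply Rmult_le_compat_l; [apply pow2_ge_0|]. apply B. left; split; nra. }
    apply (Lap_weighted_le f (fun x => Cexp (- (h * x)) - 1 - (- (h * x)))%C a b r _ s);
      [exact Ha|exact Hab|exact Bf|exact Hs| |].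
    + intros x Hx'. destruct (Hx x Hx') as [X1 X2].
      apply Rle_trans with (1 := Cmod_Cexp_minus_1_minus _).
      replace (b * b * exp b * Cmod h ^ 2) with ((Cmod h * b) ^ 2 * exp b) by ring.
      apply Rmult_le_compat; auto using Cmod_ge_0, exp_le.
      * apply pow2_ge_0.
      * left; apply exp_pos.
      * apply pow_incr; split; auto using Cmod_ge_0.
    + eapply is_RInt_ext; [|exact D2]. intros x _. simpl. rewrite Eh.
      change (@minus C_R_NormedModule) with Cminus.
      Ceq; ring.
Qed.

(* The relation for [dH] is the derivative of the one for [H]; the relation
   [(s - w) (H(s+h) - H s) = a (G(s+h) - G s) - h H(s+h)] and its second order
   analogue then gain the factor [1/d] in all four bounds. *)
Lemma taylor_bound_div (r M d : R) (a w : C) (G dG H dH : C -> C) :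
  2 <= d -> r + d <= Cmod w -> Cmod a <= 1 / 2 ->
  (forall s, (s - w) * H s = a * G s)%C ->
  (forall s, (s - w) * dH s + H s = a * dG s)%C ->
  taylor_bound r M G dG -> taylor_bound r (M / d) H dH.
Proof.
  intros Hd Hw Ha E dE B s h Hs Hsh Hh.
  assert (Hz : forall s, Cmod s <= r -> d <= Cmod (s - w)%C).
  { intros t Ht. generalize (Cmod_triangle (t - w) (- t)). rewrite Cmod_opp.
    replace (t - w + - t)%C with (- w)%C by ring. rewrite Cmod_opp. lra. }
  assert (Hq : forall z u X, d <= Cmod z -> Cmod (z * u)%C <= X -> Cmod u <= X / d).
  { intros z u X Hz' HX. rewrite Cmod_mult in HX. apply Rmult_le_reg_l with d; [lra|].
    replace (d * (X / d)) with X by (field; lra).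
    apply Rle_trans with (2 := HX). apply Rmult_le_compat_r; auto using Cmod_ge_0. }
  assert (Haa : forall u X, Cmod u <= X -> Cmod (a * u)%C <= X / 2).
  { intros u X HX. rewrite Cmod_mult. generalize (Cmod_ge_0 u) (Cmod_ge_0 a). intros. nra. }
  (* The halves coming from [|a| <= 1/2] and from [2 <= d] add up to exactly one [M]. No constant is
     lost, which matters because the division is iterated [k] times. *)
  assert (Hdd : forall X, 0 <= X -> X / d <= X / 2).
  { intros X HX. unfold Rdiv. apply Rmult_le_compat_l; auto. apply Rinv_le_contravar; lra. }
  destruct (B s h Hs Hsh Hh) as (B1 & B2 & B3 & B4).
  assert (M0 : 0 <= M) by (generalize (Cmod_ge_0 (G s)); lra).
  (* Stepping back from [s + h] by [-h] yields the bound on [G (s + h)]. *)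
  destruct (B (s + h)%C (- h)%C Hsh) as (B5 & _).
  { now replace (s + h + - h)%C with s by ring. }
  { now rewrite Cmod_opp. }
  assert (h0 := Cmod_ge_0 h).
  assert (X2 : M / 2 / d <= M / d).
  { unfold Rdiv; apply Rmult_le_compat_r; [left; apply Rinv_0_lt_compat|]; lra. }
  assert (Md : M / d <= M / 2) by auto.
  assert (C1 : forall t, Cmod t <= r -> Cmod (G t) <= M -> Cmod (H t) <= M / d).
  { intros t Ht Gt. apply Rle_trans with (M / 2 / d); auto. apply Hq with (t - w)%C; auto.
    rewrite E. auto. }
  assert (C3 : Cmod (H (s + h) - H s)%C <= M / d * Cmod h).
  { replace (M / d * Cmod h) with (M * Cmod h / d) by (field; lra).
    apply Hq with (s - w)%C; auto.
    replace ((s - w) * (H (s + h) - H s))%C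
      with (a * (G (s + h) - G s) + - (h * H (s + h)))%C.
    2:{ replace (a * (G (s + h) - G s))%C with (a * G (s + h) - a * G s)%C by ring.
        rewrite <- 2!E. ring. }
    apply Rle_trans with (1 := Cmod_triangle _ _). rewrite Cmod_opp, (Cmod_mult h).
    assert (Y := Haa _ _ B3). assert (Z := C1 _ Hsh B5). nra. }
  repeat split; auto.
  - apply Hq with (s - w)%C; auto.
    replace ((s - w) * dH s)%C with (a * dG s + - H s)%C by (rewrite <- dE; ring).
    apply Rle_trans with (1 := Cmod_triangle _ _). rewrite Cmod_opp.
    assert (Y := Haa _ _ B2). assert (Z := C1 _ Hs B1). lra.
  - replace (M / d * Cmod h ^ 2) with (M * Cmod h ^ 2 / d) by (field; lra).
    apply Hq with (s - w)%C; auto.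
    replace ((s - w) * (H (s + h) - H s - h * dH s))%C
      with (a * (G (s + h) - G s - h * dG s) + - (h * (H (s + h) - H s)))%C.
    2:{ replace (a * (G (s + h) - G s - h * dG s))%C
          with (a * G (s + h) - a * G s - h * (a * dG s))%C by ring.
        rewrite <- 2!E, <- dE. ring. }
    apply Rle_trans with (1 := Cmod_triangle _ _). rewrite Cmod_opp, (Cmod_mult h).
    assert (Y := Haa _ _ B4). nra.
Qed.

(** * Product rule and integration by parts *)

Lemma is_derive_Re (f : R -> C) (x : R) (l : C) :
  @is_derive R_AbsRing C_R_NormedModule f x l -> is_derive (fun t => fst (f t)) x (fst l).
Proof.
  intros H. apply (filterdiff_comp' f (fun z : C => fst z) x _ (fun z => fst z) H).
  apply (@filterdiff_linear R_AbsRing C_R_NormedModule R_NormedModule).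
  apply (@is_linear_fst R_AbsRing R_NormedModule R_NormedModule).
Qed.

Lemma is_derive_Im (f : R -> C) (x : R) (l : C) :
  @is_derive R_AbsRing C_R_NormedModule f x l -> is_derive (fun t => snd (f t)) x (snd l).
Proof.
  intros H. apply (filterdiff_comp' f (fun z : C => snd z) x _ (fun z => snd z) H).
  apply (@filterdiff_linear R_AbsRing C_R_NormedModule R_NormedModule).
  apply (@is_linear_snd R_AbsRing R_NormedModule R_NormedModule).
Qed.

Lemma is_derive_Cmult (f g : R -> C) (x : R) (df dg : C) :
  @is_derive R_AbsRing C_R_NormedModule f x df ->
  @is_derive R_AbsRing C_R_NormedModule g x dg ->
  @is_derive R_AbsRing C_R_NormedModule (fun t => f t * g t)%C x (df * g x + f x * dg)%C.
Proof.
  intros Hf Hg.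
  assert (f1 := is_derive_Re _ _ _ Hf). assert (f2 := is_derive_Im _ _ _ Hf).
  assert (g1 := is_derive_Re _ _ _ Hg). assert (g2 := is_derive_Im _ _ _ Hg).
  assert (M := fun u v du dv Hu Hv => @is_derive_mult R_AbsRing u v x du dv Hu Hv Rmult_comm).
  apply is_derive_pair; simpl.
  - refine (eq_rect _ (is_derive _ x) (is_derive_minus _ _ _ _ _ (M _ _ _ _ f1 g1) (M _ _ _ _ f2 g2)) _ _).
    unfold minus, plus, opp, mult; simpl. ring.
  - refine (eq_rect _ (is_derive _ x) (is_derive_plus _ _ _ _ _ (M _ _ _ _ f1 g2) (M _ _ _ _ f2 g1)) _ _).
    unfold minus, plus, opp, mult; simpl. ring.
Qed.

Lemma is_derive_RtoC (p : R -> R) (x dp : R) :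
  is_derive p x dp -> @is_derive R_AbsRing C_R_NormedModule (fun t => RtoC (p t)) x (RtoC dp).
Proof. intros H. apply is_derive_pair; simpl; auto. apply @is_derive_const. Qed.

Lemma is_derive_continuous_C (f : R -> C) (x : R) (l : C) :
  @is_derive R_AbsRing C_R_NormedModule f x l -> continuous f x.
Proof. intros H. apply (@ex_derive_continuous R_AbsRing C_R_NormedModule). now exists l. Qed.

Lemma is_derive_Cexp_opp (s : C) (x : R) :
  @is_derive R_AbsRing C_R_NormedModule (fun t : R => Cexp (- (s * t))) x (- s * Cexp (- (s * x)))%C.
Proof.
  replace (- (s * x))%C with (- s * x)%C by ring.
  refine (is_derive_ext _ _ _ _ (fun t => _) (is_derive_Cexp (- s) x)). simpl. f_equal; ring.
Qed.

(** Integration by parts: [f exp(-sx)] vanishes at both ends, so its derivative integrates to 0. *)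
Lemma Lap_derive (f df : R -> C) (a b : R) (s : C) :
  (forall x, @is_derive R_AbsRing C_R_NormedModule f x (df x)) ->
  (forall x, continuous df x) -> f a = 0%C -> f b = 0%C ->
  Lap df a b s = (s * Lap f a b s)%C.
Proof.
  intros f_derive df_continuous fa fb.
  assert (Cf : forall x, continuous f x) by (intros x; exact (is_derive_continuous_C _ _ _ (f_derive x))).
  apply CInt_unique.
  assert (H := @is_RInt_derive C_R_CompleteNormedModule _ _ a b
    (fun x _ => is_derive_Cmult _ _ x _ _ (f_derive x) (is_derive_Cexp_opp s x))).
  assert (K := is_RInt_Cmult _ _ _ s _ (Lap_correct f a b s Cf)).
  refine (is_RInt_ext _ _ _ _ _ _ (eq_rect _ (@is_RInt C_R_NormedModule _ _ _)
     (@is_RInt_plus C_R_NormedModule _ _ _ _ _ _ (H _) K) _ _)).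
  - intros x _; simpl. change (@plus C_R_NormedModule) with Cplus.
    Ceq; ring.
  - intros x _; simpl. apply (@continuous_plus _ R_AbsRing C_R_NormedModule).
    + apply continuous_Cmult; [apply df_continuous|apply continuous_Cexp_opp].
    + apply continuous_Cmult; [apply Cf|]. apply continuous_Cmult; [apply continuous_const|].
      apply continuous_Cexp_opp.
  - simpl. change (@plus C_R_NormedModule) with Cplus. change (@minus C_R_CompleteNormedModule) with Cminus.
    rewrite fa, fb. Ceq; ring.
Qed.

Lemma Lap_lin (f g h : R -> C) (a b : R) (u v s : C) :
  (forall x, continuous f x) -> (forall x, continuous g x) ->
  (forall x, h x = u * f x + v * g x)%C ->
  Lap h a b s = (u * Lap f a b s + v * Lap g a b s)%C.
Proof.
  intros Hf Hg Hh. apply CInt_unique.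
  refine (is_RInt_ext _ _ _ _ _ _ (@is_RInt_plus C_R_NormedModule _ _ _ _ _ _
    (is_RInt_Cmult _ _ _ u _ (Lap_correct f a b s Hf)) (is_RInt_Cmult _ _ _ v _ (Lap_correct g a b s Hg)))).
  intros x _. rewrite Hh. simpl. change (@plus C_R_NormedModule) with Cplus.
  Ceq; ring.
Qed.

(** This is [Lap_derive] differentiated in [s]. It follows from [Lap_derive] itself, applied to
    [-x f], which also vanishes at both ends and has derivative [-f - x f']. *)
Lemma Lap_moment_derive (f df : R -> C) (a b : R) (s : C) :
  (forall x, @is_derive R_AbsRing C_R_NormedModule f x (df x)) ->
  (forall x, continuous df x) -> f a = 0%C -> f b = 0%C ->
  Lap (fun x => - x * df x)%C a b s = (s * Lap (fun x => - x * f x)%C a b s + Lap f a b s)%C.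
Proof.
  intros Df Cdf fa fb.
  assert (Cf : forall x, continuous f x) by (intros x; exact (is_derive_continuous_C _ _ _ (Df x))).
  assert (D : forall x : R, @is_derive R_AbsRing C_R_NormedModule (fun t : R => - t * f t)%C x
     (-1 * f x + - x * df x)%C).
  { intros x. apply is_derive_Cmult; [|apply Df].
    apply (is_derive_ext (fun t : R => RtoC (- t))); [intros t; now rewrite RtoC_opp|].
    apply is_derive_RtoC. auto_derive; auto. }
  assert (C1 := continuous_moment _ Cdf).
  rewrite <- (Lap_derive _ _ a b s D).
  - rewrite (Lap_lin f (fun x => - x * df x)%C (fun x => -1 * f x + - x * df x)%C a b (-1) 1 s); auto.
    + ring.
    + intros x; ring.
  - intros x. apply (@continuous_plus _ R_AbsRing C_R_NormedModule); auto.
    apply continuous_Cmult; auto. apply continuous_const.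
  - rewrite fa; ring.
  - rewrite fb; ring.
Qed.

(** * The oscillating bumps and the decay of their transforms *)

(* For [1 <= j], [wave] vanishes at every multiple of [2 pi k]. *)
Definition wave (L k j : nat) (x : R) : C :=
  (RtoC (sin (x / (2 * INR k)) ^ j) * Cexp (Ci * RtoC (INR L + INR j / (2 * INR k)) * x))%C.

(** For [j = 0] the index [pred j] is 0 again, but then the first coefficient vanishes. *)
Definition dwave (L k j : nat) (x : R) : C :=
  (RtoC (INR j / (2 * INR k)) * wave L k (pred j) x + Ci * RtoC (INR L + INR j / INR k) * wave L k j x)%C.

Lemma Cmod_Cexp_imag (w x : R) : Cmod (Cexp (Ci * w * x)) = 1.
Proof. rewrite Cmod_Cexp. simpl. rewrite <- exp_0. f_equal; ring. Qed.

Lemma Cmod_wave (L k j : nat) (x : R) : Cmod (wave L k j x) = Rabs (sin (x / (2 * INR k)) ^ j).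
Proof. unfold wave. now rewrite Cmod_mult, Cmod_Cexp_imag, Rmult_1_r, Cmod_R. Qed.

Lemma Cmod_wave_le (L k j : nat) (x : R) : Cmod (wave L k j x) <= 1.
Proof.
  rewrite Cmod_wave, <- RPow_abs. rewrite <- (pow1 j). apply pow_incr; split; [apply Rabs_pos|].
  apply Rabs_le, SIN_bound.
Qed.

(** With [y = x/2k], write [cos y = exp(-iy) + i sin y] in the derivative of the power of the sine.
    The first term lowers the phase to that of index [j - 1], just as the power has dropped; the
    second restores the power and doubles the contribution [j/2k] of the phase. *)
Lemma is_derive_wave (L k j : nat) (x : R) : k <> 0%nat ->
  @is_derive R_AbsRing C_R_NormedModule (wave L k j) x (dwave L k j x).
Proof.
  intros Hk. assert (Hk' : INR k <> 0) by now apply not_0_INR.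
  set (y := x / (2 * INR k)).
  refine (eq_rect _ (@is_derive R_AbsRing C_R_NormedModule _ x)
    (is_derive_Cmult _ _ x _ _ (is_derive_RtoC _ x (INR j * (cos y / (2 * INR k)) * sin y ^ pred j) _)
       (is_derive_Cexp _ x)) _ _).
  - auto_derive; auto. unfold y, Rdiv. ring.
  - Ceq.
    unfold dwave, wave. fold y.
    set (q := INR j / (2 * INR k)).
    replace (INR j * (cos y / (2 * INR k))) with (q * cos y) by (unfold q; field; auto).
    replace (INR j / INR k) with (q + q) by (unfold q; field; auto).
    rewrite !RtoC_plus, !RtoC_mult.
    destruct j as [|m].
    { replace q with 0 by (unfold q; simpl; field; auto). simpl pred. simpl pow. ring. }
    simpl pred. simpl pow. rewrite RtoC_mult.
    set (e := Cexp (Ci * (INR L + q) * x)).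
    set (e' := Cexp (Ci * (INR L + RtoC (INR m / (2 * INR k))) * x)).
    assert (Ee : e = (e' * (cos y, sin y))%C).
    { unfold e, e'. replace (cos y, sin y) with (Cexp (Ci * y)).
      - rewrite <- Cexp_plus. f_equal. unfold q, y. rewrite S_INR, !RtoC_div, !RtoC_mult, !RtoC_plus; auto.
        field. intros Z; apply RtoC_inj in Z; lra.
      - replace (Ci * y)%C with (0, y) by (unfold Ci, RtoC, Cmult; simpl; f_equal; ring).
        unfold Cexp; simpl. rewrite exp_0. f_equal; ring. }
    assert (Ec : (cos y * e = e' + Ci * sin y * e)%C).
    { rewrite Ee. replace (cos y * (e' * (cos y, sin y)))%C with (e' * (cos y * (cos y, sin y)))%C by ring.
      replace (e' + Ci * sin y * (e' * (cos y, sin y)))%C with (e' * (1 + Ci * sin y * (cos y, sin y)))%C by ring.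
      f_equal. assert (T := sin2_cos2 y). unfold Rsqr in T.
      unfold Ci, RtoC, Cmult, Cplus; simpl. f_equal; nra. }
    replace (q * cos y * (sin y ^ m)%R * e)%C with (q * (sin y ^ m)%R * (cos y * e))%C by ring.
    rewrite Ec. ring.
Qed.

Lemma wave_zero (L k j n : nat) : k <> 0%nat -> j <> 0%nat -> wave L k j (2 * PI * INR k * INR n) = 0%C.
Proof.
  intros Hk Hj. assert (Hk' : INR k <> 0) by now apply not_0_INR.
  unfold wave. replace (2 * PI * INR k * INR n / (2 * INR k)) with (INR n * PI) by (field; auto).
  replace (sin (INR n * PI)) with 0; [rewrite pow_i by lia; ring|].
  symmetry. apply sin_eq_0_1. exists (Z.of_nat n). now rewrite INR_IZR_INZ.
Qed.

Lemma continuous_wave (L k j : nat) (x : R) : k <> 0%nat -> continuous (wave L k j) x.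
Proof. intros Hk. exact (is_derive_continuous_C _ _ _ (is_derive_wave L k j x Hk)). Qed.

Lemma continuous_dwave (L k j : nat) (x : R) : k <> 0%nat -> continuous (dwave L k j) x.
Proof.
  intros Hk. apply (@continuous_plus _ R_AbsRing C_R_NormedModule); apply continuous_Cmult;
    try apply continuous_const; now apply continuous_wave.
Qed.

(** At [j = k] the coefficients are 1/2 and [L + 1], whatever [k] is: the slowness of [sin(x/2k)]
    compensates for its high power. *)
Lemma Cmod_dwave_le (L k : nat) (x : R) : k <> 0%nat -> Cmod (dwave L k k x) <= INR L + 2.
Proof.
  intros Hk. assert (Hk' : INR k <> 0) by now apply not_0_INR.
  assert (L0 := pos_INR L).
  apply Rle_trans with (1 := Cmod_triangle _ _). rewrite 2!Cmod_mult, Cmod_R.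
  replace (INR k / (2 * INR k)) with (/ 2) by (field; auto).
  replace (INR k / INR k) with 1 by (field; auto).
  rewrite Cmod_mult, Cmod_Ci, Cmod_R, 2!Rabs_pos_eq by lra.
  generalize (Cmod_wave_le L k (pred k) x) (Cmod_wave_le L k k x)
   (Cmod_ge_0 (wave L k (pred k) x)) (Cmod_ge_0 (wave L k k x)). intros. nra.
Qed.

Definition wave_Lap (L k j : nat) : C -> C := Lap (wave L k j) (2 * PI * INR k) (4 * PI * INR k).
Definition wave_dLap (L k j : nat) : C -> C :=
  Lap (fun x => - x * wave L k j x)%C (2 * PI * INR k) (4 * PI * INR k).

Lemma wave_ends (L k j : nat) : k <> 0%nat -> j <> 0%nat ->
  wave L k j (2 * PI * INR k) = 0%C /\ wave L k j (4 * PI * INR k) = 0%C.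
Proof.
  intros Hk Hj. split.
  - replace (2 * PI * INR k) with (2 * PI * INR k * INR 1) by (simpl; ring). now apply wave_zero.
  - replace (4 * PI * INR k) with (2 * PI * INR k * INR 2) by (simpl; ring). now apply wave_zero.
Qed.

(** Induction on [j] from the trivial bound. The point [i (L + j/k)] has modulus at least [L], hence
    distance at least [L - r >= 2] from the disc, and [taylor_bound_div] gains a factor [1/(L - r)]
    at each step. *)
Lemma wave_taylor_bound (L k j : nat) (r : R) :
  k <> 0%nat -> (j <= k)%nat -> r + 2 <= INR L ->
  taylor_bound r (exp ((r + 4) * (4 * PI * INR k)) / (INR L - r) ^ j) (wave_Lap L k j) (wave_dLap L k j).
Proof.
  intros Hk Hj HL.
  assert (Hk' : 0 < INR k) by (apply lt_0_INR; lia). assert (HPI := PI_RGT_0).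
  assert (PK : 0 < PI * INR k) by nra.
  induction j as [|j IH].
  - simpl pow. rewrite Rdiv_1_r. apply Lap_taylor_bound; try lra.
    + intros x. now apply continuous_wave.
    + apply Cmod_wave_le.
  - replace (_ / _) with (exp ((r + 4) * (4 * PI * INR k)) / (INR L - r) ^ j / (INR L - r))
      by (simpl; field; repeat split; try apply pow_nonzero; lra).
    destruct (wave_ends L k (S j) Hk) as [Wa Wb]; [lia|].
    assert (D := fun x => is_derive_wave L k (S j) x Hk).
    assert (Cd := fun x => continuous_dwave L k (S j) x Hk).
    assert (Cw := fun i x => continuous_wave L k i x Hk).
    (* The index does not exceed [k], which keeps the coefficient of the recursion at most 1/2. *)
    assert (Hq : 0 <= INR (S j) / INR k <= 1).
    { assert (0 <= INR (S j)) by apply pos_INR. apply le_INR in Hj. split.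
      - apply Rdiv_le_0_compat; lra.
      - apply Rmult_le_reg_r with (INR k); auto. unfold Rdiv. rewrite Rmult_assoc, Rinv_l; lra. }
    apply (taylor_bound_div r _ (INR L - r) (RtoC (INR (S j) / (2 * INR k))) (Ci * RtoC (INR L + INR (S j) / INR k))%C
       (wave_Lap L k j) (wave_dLap L k j)).
    + lra.
    + assert (L0 := pos_INR L). rewrite Cmod_mult, Cmod_Ci, Cmod_R, Rabs_pos_eq; lra.
    + rewrite Cmod_R. replace (INR (S j) / (2 * INR k)) with (INR (S j) / INR k / 2) by (field; lra).
      rewrite Rabs_pos_eq; lra.
    + intros s. assert (E := Lap_derive _ _ _ _ s D Cd Wa Wb).
      rewrite (Lap_lin (wave L k j) (wave L k (S j)) (dwave L k (S j)) _ _ (RtoC (INR (S j) / (2 * INR k)))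
        (Ci * RtoC (INR L + INR (S j) / INR k))%C s (Cw j) (Cw (S j)) (fun x => eq_refl)) in E.
      fold (wave_Lap L k j) (wave_Lap L k (S j)) in E.
      replace ((s - (Ci * RtoC (INR L + INR (S j) / INR k))%C) * wave_Lap L k (S j) s)%C
        with (s * wave_Lap L k (S j) s - (Ci * RtoC (INR L + INR (S j) / INR k))%C * wave_Lap L k (S j) s)%C by ring.
      rewrite <- E. ring.
    + intros s. assert (E := Lap_moment_derive _ _ _ _ s D Cd Wa Wb).
      rewrite (Lap_lin (fun x => - x * wave L k j x)%C (fun x => - x * wave L k (S j) x)%C _ _ _
        (RtoC (INR (S j) / (2 * INR k))) (Ci * RtoC (INR L + INR (S j) / INR k))%C s) in E.
      * fold (wave_Lap L k (S j)) (wave_dLap L k j) (wave_dLap L k (S j)) in E.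
        replace ((s - (Ci * RtoC (INR L + INR (S j) / INR k))%C) * wave_dLap L k (S j) s + wave_Lap L k (S j) s)%C
          with (s * wave_dLap L k (S j) s + wave_Lap L k (S j) s
                - (Ci * RtoC (INR L + INR (S j) / INR k))%C * wave_dLap L k (S j) s)%C by ring.
        rewrite <- E. ring.
      * intros x. now apply continuous_moment.
      * intros x. now apply continuous_moment.
      * intros x. unfold dwave. simpl pred. ring.
    + apply IH. lia.
Qed.

(** * Series of functions with second order bounds have entire sums *)

Lemma is_derive_of_taylor_bound (F : C -> C) (z d : C) (K : R) :
  (forall h : C, Cmod h <= 1 -> Cmod (F (z + h) - F z - h * d)%C <= K * Cmod h ^ 2) ->
  @is_derive C_AbsRing C_NormedModule F z d.
Proof.
  intros H. split; [apply (@is_linear_scal_l C_AbsRing C_NormedModule)|].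
  intros x Hx. rewrite <- (is_filter_lim_locally_unique _ _ Hx). clear x Hx.
  intros [e He].
  assert (K0 : 0 <= Rabs K) by apply Rabs_pos.
  (* [Rabs K + 1] is positive even if [K] is zero or negative. *)
  assert (Hd : 0 < Rmin 1 (e / (Rabs K + 1))).
  { apply Rmin_pos; [lra|]. apply Rdiv_lt_0_compat; lra. }
  exists (mkposreal _ Hd). intros y Hy.
  change (Cmod (y - z)%C < Rmin 1 (e / (Rabs K + 1))) in Hy.
  change (Cmod (F y - F z - (y - z) * d)%C <= e * Cmod (y - z)%C).
  set (h := (y - z)%C) in *. replace y with (z + h)%C by (unfold h; ring).
  assert (h0 := Cmod_ge_0 h).
  assert (H1 : Cmod h <= 1) by (generalize (Rmin_l 1 (e / (Rabs K + 1))); lra).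
  apply Rle_trans with (1 := H h H1). simpl. rewrite Rmult_1_r, <- Rmult_assoc.
  apply Rmult_le_compat_r; auto.
  apply Rle_trans with ((Rabs K + 1) * Cmod h).
  - apply Rmult_le_compat_r; auto. generalize (Rle_abs K); lra.
  - replace e with ((Rabs K + 1) * (e / (Rabs K + 1))) by (field; lra).
    apply Rmult_le_compat_l; [lra|]. generalize (Rmin_r 1 (e / (Rabs K + 1))); lra.
Qed.

Lemma Cmod_series_le (g : nat -> C) (l : C) (c : nat -> R) :
  (forall n, Cmod (g n) <= c n) -> ex_series c ->
  @is_series R_AbsRing C_R_NormedModule g l -> Cmod l <= Series c.
Proof.
  intros Hg Hc Hl.
  assert (L1 : is_lim_seq (fun n => Cmod (@sum_n C_R_NormedModule g n)) (Cmod l)).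
  { assert (N := filterlim_comp _ _ _ _ _ _ _ _ Hl (@filterlim_norm R_AbsRing C_R_NormedModule l)).
    rewrite norm_Cmod in N.
    refine (filterlim_ext _ _ _ N). intros n. apply norm_Cmod. }
  assert (L2 := Series_correct _ Hc).
  refine (is_lim_seq_le _ _ (Cmod l) (Series c) _ L1 L2). intros n.
  induction n as [|n IH]; [rewrite 2!sum_O; apply Hg|].
  rewrite 2!sum_Sn. apply Rle_trans with (1 := Cmod_triangle _ _).
  apply Rplus_le_compat; auto.
Qed.

(** The remainders of the terms at [z] are at most [c n |h|^2], so the remainder of the sum is at
    most [|h|^2] times [Series c]: the sum of the [dG n z] is the derivative. *)
Lemma entire_series (G dG : nat -> C -> C) :
  (forall r, exists c : nat -> R, ex_series c /\ forall n, taylor_bound r (c n) (G n) (dG n)) ->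
  exists F : C -> C, entire F /\
    forall s, @is_series R_AbsRing C_R_NormedModule (fun n => G n s) (F s).
Proof.
  intros H.
  assert (B0 : forall c r n, taylor_bound r (c n) (G n) (dG n) -> forall s, Cmod s <= r ->
     Cmod (G n s) <= c n /\ Cmod (dG n s) <= c n).
  { intros c r n B s Hs. destruct (B s 0%C Hs) as (B1 & B2 & _); auto.
    - now rewrite Cplus_0_r.
    - rewrite Cmod_0; lra. }
  assert (X : forall s, exists p : C * C,
    @is_series R_AbsRing C_R_NormedModule (fun n => G n s) (fst p) /\
    @is_series R_AbsRing C_R_NormedModule (fun n => dG n s) (snd p)).
  { intros s. destruct (H (Cmod s)) as (c & Hc & B).
    destruct (@ex_series_le R_AbsRing C_R_CompleteNormedModule (fun n => G n s) c) as [l1 H1]; auto.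
    { intros n. refine (Rle_trans _ _ _ (Req_le _ _ (norm_Cmod _)) _). apply (B0 _ (Cmod s)); auto; lra. }
    destruct (@ex_series_le R_AbsRing C_R_CompleteNormedModule (fun n => dG n s) c) as [l2 H2]; auto.
    { intros n. refine (Rle_trans _ _ _ (Req_le _ _ (norm_Cmod _)) _). apply (B0 _ (Cmod s)); auto; lra. }
    exists (l1, l2). now split. }
  (* The majorant depends on [r]; choosing the sums pointwise in [s] gives a single [F] for all
     discs. *)
  apply functional_choice in X. destruct X as [P HP].
  exists (fun s => fst (P s)). split; [|intros s; exact (proj1 (HP s))].
  intros z. exists (snd (P z)).
  (* The radius [|z| + 1] keeps [z + h] in the disc for [|h| <= 1]. *)
  destruct (H (Cmod z + 1)) as (c & Hc & B).
  apply (is_derive_of_taylor_bound _ _ _ (Series c)). intros h Hh.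
  rewrite Rmult_comm, <- Series_scal_l.
  assert (S1 := proj1 (HP (z + h)%C)). assert (S0 := proj1 (HP z)). assert (D0 := proj2 (HP z)).
  assert (S := is_series_minus _ _ _ _ (is_series_minus _ _ _ _ S1 S0)
     (@is_series_scal C_AbsRing C_NormedModule h _ _ D0)).
  refine (Cmod_series_le _ _ _ _ _ S).
  - intros n. rewrite (Rmult_comm _ (c n)). apply (B n z h); auto; [lra|].
    apply Rle_trans with (1 := Cmod_triangle _ _); lra.
  - exact (ex_series_scal (V := R_NormedModule) (Cmod h ^ 2) c Hc).
Qed.

(** * Extension by zero outside an interval *)

(* When [f a = f b = 0] this is [f] extended by zero outside [[a, b]]. *)
Definition clamp (a b : R) (f : R -> C) (x : R) : C := f (Rmax a (Rmin x b)).

Lemma clamp_in (a b : R) (f : R -> C) (x : R) : a <= x <= b -> clamp a b f x = f x.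
Proof. intros H. unfold clamp. rewrite Rmin_left, Rmax_right; tauto || lra. Qed.

Lemma clamp_out (a b : R) (f : R -> C) (x : R) :
  a <= b -> f a = 0%C -> f b = 0%C -> x <= a \/ b <= x -> clamp a b f x = 0%C.
Proof.
  intros H fa fb [H'|H']; unfold clamp.
  - rewrite Rmin_left, Rmax_left; tauto || lra.
  - rewrite Rmin_right, Rmax_right; tauto || lra.
Qed.

Lemma continuous_clamp (a b : R) (f : R -> C) (x : R) :
  (forall t, continuous f t) -> continuous (clamp a b f) x.
Proof.
  intros Hf. apply (continuous_comp (fun t => Rmax a (Rmin t b)) f); [|apply Hf].
  (* Projection onto [a, b] is 1-Lipschitz, so the same [eps] serves. *)
  apply filterlim_locally. intros eps. exists eps. intros y Hy.
  apply Rle_lt_trans with (2 := Hy).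
  unfold abs, minus, plus, opp; simpl.
  unfold Rmax, Rmin, Rabs. repeat destruct Rle_dec; repeat destruct Rcase_abs; lra.
Qed.

(** Here [f] is [o(y - x)] at [x], and domination passes this on to [g]. It is meant for the ends of
    a support, where the extension by zero is glued. *)
Lemma is_derive_of_dominated (f g : R -> C) (x : R) :
  @is_derive R_AbsRing C_R_NormedModule f x (RtoC 0) -> f x = 0%C -> g x = 0%C ->
  (forall y, Cmod (g y) <= Cmod (f y)) ->
  @is_derive R_AbsRing C_R_NormedModule g x (RtoC 0).
Proof.
  intros [Lf Df] fx gx H. split; [exact Lf|].
  intros y Hy e. generalize (Df y Hy e). apply filter_imp. intros t Ht.
  rewrite <- (is_filter_lim_locally_unique _ _ Hy) in *.
  refine (Rle_trans _ _ _ _ Ht). rewrite fx, gx, !norm_Cmod.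
  assert (E : forall u v : C, v = 0%C -> @minus C_R_NormedModule (@minus C_R_NormedModule u (RtoC 0)) v = u).
  { intros u v ->. change (@minus C_R_NormedModule) with Cminus. Ceq; ring. }
  rewrite !E; auto; apply (@scal_zero_r R_AbsRing C_R_NormedModule).
Qed.

(** Off the ends the extension agrees locally with 0 or with [f]; at the ends, where [f] and [df]
    both vanish, it is dominated by [f]. *)
Lemma is_derive_clamp (a b : R) (f df : R -> C) (x : R) :
  a < b -> (forall t, @is_derive R_AbsRing C_R_NormedModule f t (df t)) ->
  f a = 0%C -> f b = 0%C -> df a = 0%C -> df b = 0%C ->
  @is_derive R_AbsRing C_R_NormedModule (clamp a b f) x (clamp a b df x).
Proof.
  intros Hab Df fa fb dfa dfb.
  assert (Dom : forall y, Cmod (clamp a b f y) <= Cmod (f y)).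
  { intros y. destruct (Rle_dec y a) as [Y|Y]; [|destruct (Rle_dec b y) as [Y'|Y']].
    - rewrite clamp_out, Cmod_0; auto using Cmod_ge_0; lra.
    - rewrite clamp_out, Cmod_0; auto using Cmod_ge_0; lra.
    - rewrite clamp_in; lra. }
  destruct (Rlt_le_dec x a) as [X|[X|X]%Rle_lt_or_eq_dec].
  - rewrite clamp_out; auto; try lra.
    refine (@is_derive_ext_loc R_AbsRing C_R_NormedModule (fun _ => RtoC 0) _ _ _ _ (@is_derive_const R_AbsRing C_R_NormedModule _ _)).
    assert (P : 0 < a - x) by lra. exists (mkposreal _ P). intros y Hy. symmetry. apply clamp_out; auto; try lra.
    left. apply Rabs_def2 in Hy. simpl in Hy. unfold minus, plus, opp in Hy; simpl in Hy. lra.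
  - destruct (Rlt_le_dec b x) as [X'|[X'|X']%Rle_lt_or_eq_dec].
    + rewrite clamp_out; auto; try lra.
      refine (@is_derive_ext_loc R_AbsRing C_R_NormedModule (fun _ => RtoC 0) _ _ _ _ (@is_derive_const R_AbsRing C_R_NormedModule _ _)).
      assert (P : 0 < x - b) by lra. exists (mkposreal _ P). intros y Hy. symmetry. apply clamp_out; auto; try lra.
      right. apply Rabs_def2 in Hy. simpl in Hy. unfold minus, plus, opp in Hy; simpl in Hy. lra.
    + rewrite clamp_in by lra.
      refine (@is_derive_ext_loc R_AbsRing C_R_NormedModule f _ _ _ _ (Df x)).
      assert (P : 0 < Rmin (x - a) (b - x)) by (apply Rmin_pos; lra).
      exists (mkposreal _ P). intros y Hy. symmetry. apply clamp_in.
      apply Rabs_def2 in Hy. simpl in Hy. unfold minus, plus, opp in Hy; simpl in Hy.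
      generalize (Rmin_l (x - a) (b - x)) (Rmin_r (x - a) (b - x)); lra.
    + subst x. rewrite (clamp_in a b df), dfb by lra.
      apply (is_derive_of_dominated f); auto; [|rewrite clamp_in; auto; lra].
      rewrite <- dfb; apply Df.
  - subst x. rewrite (clamp_in a b df), dfa by lra.
    apply (is_derive_of_dominated f); auto; [|rewrite clamp_in; auto; lra].
    rewrite <- dfa; apply Df.
Qed.

(** * Locally finite sums *)

(* For a locally finite family [total] is the full sum: the terms past
   [up x] vanish at [x]. *)
Definition total (g : nat -> R -> C) (x : R) : C :=
  @sum_n C_R_NormedModule (fun n => g n x) (Z.to_nat (up x)).

Definition locally_finite (g : nat -> R -> C) : Prop :=
  forall n x, x <= INR n -> g n x = 0%C.

Lemma sum_n_stable (c : nat -> C) (m n : nat) :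
  (m <= n)%nat -> (forall i, (m < i)%nat -> c i = 0%C) ->
  @sum_n C_R_NormedModule c n = @sum_n C_R_NormedModule c m.
Proof.
  intros Hmn H. induction Hmn as [|n Hmn IH]; auto.
  rewrite sum_Sn, IH, H by lia. apply (@plus_zero_r C_R_NormedModule).
Qed.

Lemma up_le (x : R) : x <= INR (Z.to_nat (up x)).
Proof.
  destruct (archimed x) as [H _]. rewrite INR_IZR_INZ.
  destruct (Z.le_ge_cases 0 (up x)) as [Z|Z].
  - rewrite Z2Nat.id; auto; lra.
  (* When [up x <= 0], [Z.to_nat] returns 0, which is still above [x]. *)
  - apply IZR_le in Z. apply Rle_trans with 0; [lra|]. apply (IZR_le 0); lia.
Qed.

(** [N] and [up x] are both valid cut-offs, so each partial sum equals the one up to their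
    maximum. *)
Lemma total_eq (g : nat -> R -> C) (x : R) (N : nat) :
  locally_finite g -> (forall n, (N < n)%nat -> g n x = 0%C) ->
  total g x = @sum_n C_R_NormedModule (fun n => g n x) N.
Proof.
  intros Hg H. unfold total.
  rewrite <- (sum_n_stable _ _ (max N (Z.to_nat (up x))) (Nat.le_max_l _ _) H).
  symmetry. apply sum_n_stable; [apply Nat.le_max_r|].
  intros i Hi. apply Hg. apply Rle_trans with (1 := up_le x). apply le_INR; lia.
Qed.

Lemma total_eq_of_le (g : nat -> R -> C) (x : R) (N : nat) :
  locally_finite g -> x <= INR N -> total g x = @sum_n C_R_NormedModule (fun n => g n x) N.
Proof.
  intros Hg HN. apply total_eq; auto. intros n Hn. apply Hg.
  apply Rle_trans with (1 := HN). apply le_INR; lia.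
Qed.

Lemma sum_n_zero (c : nat -> C) (n : nat) :
  (forall m, (m <= n)%nat -> c m = 0%C) -> @sum_n C_R_NormedModule c n = RtoC 0.
Proof.
  intros H. induction n as [|n IH]; [rewrite sum_O; auto|].
  rewrite sum_Sn, IH, H; auto. apply (@plus_zero_l C_R_NormedModule).
Qed.

Lemma total_single (g : nat -> R -> C) (x : R) (n : nat) :
  locally_finite g -> (forall m, m <> n -> g m x = 0%C) -> total g x = g n x.
Proof.
  intros Hg H. rewrite (total_eq g x n Hg) by (intros; apply H; lia).
  destruct n as [|n]; [exact (@sum_O C_R_NormedModule (fun n => g n x))|].
  rewrite sum_Sn, sum_n_zero by (intros; apply H; lia).
  apply (@plus_zero_l C_R_NormedModule).
Qed.

Lemma locally_le (x N : R) : x < N -> locally x (fun y => y <= N).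
Proof.
  intros H. assert (P : 0 < N - x) by lra. exists (mkposreal _ P). intros y Hy.
  apply Rabs_def2 in Hy. simpl in Hy. unfold minus, plus, opp in Hy; simpl in Hy. lra.
Qed.

(** All points near [x] lie below one integer [N], so that locally the total is a fixed finite
    sum. *)
Lemma is_derive_total (g dg : nat -> R -> C) (x : R) :
  locally_finite g -> locally_finite dg ->
  (forall n, @is_derive R_AbsRing C_R_NormedModule (g n) x (dg n x)) ->
  @is_derive R_AbsRing C_R_NormedModule (total g) x (total dg x).
Proof.
  intros Hg Hdg D. destruct (INR_unbounded x) as [N HN].
  rewrite (total_eq_of_le dg x N) by (auto; lra).
  apply (@is_derive_ext_loc R_AbsRing C_R_NormedModule (fun y => @sum_n C_R_NormedModule (fun n => g n y) N)).
  - generalize (locally_le x (INR N) HN). apply filter_imp. intros y Hy. now rewrite (total_eq_of_le g y N).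
  - apply (is_derive_sum_n (V := C_R_NormedModule) g). auto.
Qed.

Lemma continuous_total (g : nat -> R -> C) (x : R) :
  locally_finite g -> (forall n, continuous (g n) x) -> continuous (total g) x.
Proof.
  intros Hg Cg. destruct (INR_unbounded x) as [N HN].
  apply (continuous_ext_loc _ (fun y => @sum_n C_R_NormedModule (fun n => g n y) N)).
  - generalize (locally_le x (INR N) HN). apply filter_imp. intros y Hy. now rewrite (total_eq_of_le g y N).
  - induction N as [|N IH] in |- *.
    + apply (continuous_ext (g 0%nat)); auto. intros y; now rewrite sum_O.
    + apply (continuous_ext (fun y => @plus C_R_NormedModule
        (@sum_n C_R_NormedModule (fun n => g n y) N) (g (S N) y))); [intros y; now rewrite sum_Sn|].
      now apply (@continuous_plus _ R_AbsRing C_R_NormedModule).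
Qed.

(** * Integrals and Laplace transforms of locally finite sums *)

Lemma is_RInt_sum_n (g : nat -> R -> C) (l : nat -> C) (a b : R) (N : nat) :
  (forall n, (n <= N)%nat -> @is_RInt C_R_NormedModule (g n) a b (l n)) ->
  @is_RInt C_R_NormedModule (fun x => @sum_n C_R_NormedModule (fun n => g n x) N) a b
    (@sum_n C_R_NormedModule l N).
Proof.
  intros H. induction N as [|N IH].
  - rewrite sum_O. apply (is_RInt_ext (g 0%nat)); auto. intros x _; now rewrite sum_O.
  - rewrite sum_Sn. apply (is_RInt_ext (fun x => @plus C_R_NormedModule
        (@sum_n C_R_NormedModule (fun n => g n x) N) (g (S N) x))); [intros x _; now rewrite sum_Sn|].
    apply (@is_RInt_plus C_R_NormedModule); auto.
Qed.

Lemma is_RInt_clamp (a b c : R) (f : R -> C) (l : C) (s : C) :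
  0 <= a -> a < b -> b <= c -> f a = 0%C -> f b = 0%C ->
  @is_RInt C_R_NormedModule (fun x => f x * Cexp (- (s * x)))%C a b l ->
  @is_RInt C_R_NormedModule (fun x => clamp a b f x * Cexp (- (s * x)))%C 0 c l.
Proof.
  intros Ha Hab Hbc fa fb H.
  assert (Z : forall u v, u <= v -> v <= a \/ b <= u ->
    @is_RInt C_R_NormedModule (fun x => clamp a b f x * Cexp (- (s * x)))%C u v (RtoC 0)).
  { intros u v Huv Hd.
    apply (is_RInt_ext (fun _ => RtoC 0)).
    - intros x. rewrite Rmin_left, Rmax_right by lra. intros Hx. rewrite clamp_out; auto; try lra.
      now rewrite Cmult_0_l.
    - exact (eq_rect _ (@is_RInt C_R_NormedModule _ u v) (@is_RInt_const C_R_NormedModule u v (RtoC 0))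
        _ (@scal_zero_r R_AbsRing C_R_NormedModule (v - u))). }
  replace l with (@plus C_R_NormedModule (@plus C_R_NormedModule (RtoC 0) l) (RtoC 0)).
  - apply (@is_RInt_Chasles C_R_NormedModule _ 0 b c); [apply (@is_RInt_Chasles C_R_NormedModule _ 0 a b)|];
      try (apply Z; lra).
    apply (is_RInt_ext (fun x => f x * Cexp (- (s * x)))%C); auto.
    intros x. rewrite Rmin_left, Rmax_right by lra. intros Hx. rewrite clamp_in; auto; lra.
  - change (@plus C_R_NormedModule) with Cplus. Ceq; ring.
Qed.

(** The integral up to [b N] is exactly a partial sum of the series. For any larger upper limit,
    even inside a bump, the bound [|total g| <= 1] leaves an error of at most a tail of the integral
    of [exp(- Re s x)]. *)
Lemma is_Laplace_of_series (g : nat -> R -> C) (b : nat -> R) (G : nat -> C) (s l : C) :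
  0 < Re s -> locally_finite g -> (forall n x, continuous (g n) x) ->
  (forall x, Cmod (total g x) <= 1) -> (forall n, INR n <= b n) ->
  (forall N n, (N < n)%nat -> forall x, x <= b N -> g n x = 0%C) ->
  (forall N n, (n <= N)%nat ->
    @is_RInt C_R_NormedModule (fun x => g n x * Cexp (- (s * x)))%C 0 (b N) (G n)) ->
  @is_series R_AbsRing C_R_NormedModule G l ->
  is_Laplace (total g) s l.
Proof.
  intros Hs Hg Cg Bg Hb Hgb HI HG.
  set (f := fun x : R => (total g x * Cexp (- (s * x)))%C).
  assert (Cf : forall x, continuous f x).
  { apply continuous_Lap. intros x; apply continuous_total; auto. }
  assert (IN : forall N, CInt f 0 (b N) = @sum_n C_R_NormedModule G N).
  { intros N. apply CInt_unique.
    refine (is_RInt_ext _ _ _ _ _ _ (is_RInt_sum_n _ _ _ _ N (HI N))).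
    assert (b0 : 0 <= b N) by (generalize (Hb N) (pos_INR N); lra).
    intros x. rewrite Rmin_left, Rmax_right by lra. intros Hx. unfold f.
    rewrite (total_eq g x N); auto; [|intros n Hn; apply (Hgb N); auto; lra].
    clear. induction N as [|N IH]; [now rewrite 2!sum_O|]. rewrite 2!sum_Sn, IH.
    change (@plus C_R_NormedModule) with Cplus. Ceq; ring. }
  (* The tail is at most [exp(- Re s b_N) / Re s], and [exp(-t) <= 1/t] makes the bound rational. *)
  assert (Tail : forall N c, b N <= c -> 0 < b N -> Cmod (CInt f 0 c - CInt f 0 (b N))%C <= / (Re s * Re s * b N)).
  { intros N c Hc b0.
    assert (Ch := @is_RInt_Chasles C_R_NormedModule f 0 (b N) c _ _ (CInt_correct f _ _ Cf) (CInt_correct f _ _ Cf)).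
    apply CInt_unique in Ch. rewrite Ch. change (@plus C_R_NormedModule) with Cplus.
    replace (CInt f 0 (b N) + CInt f (b N) c - CInt f 0 (b N))%C with (CInt f (b N) c) by ring.
    assert (J : is_RInt (fun x => exp (- Re s * x)) (b N) c
       (minus (exp (- Re s * c) * / (- Re s)) (exp (- Re s * b N) * / (- Re s)))).
    { apply (is_RInt_derive (V := R_CompleteNormedModule) (fun x => exp (- Re s * x) * / (- Re s))).
      - intros x _. auto_derive; auto. field; lra.
      - intros x _. apply (@ex_derive_continuous R_AbsRing R_NormedModule). auto_derive; auto. }
    apply Rle_trans with (minus (exp (- Re s * c) * / (- Re s)) (exp (- Re s * b N) * / (- Re s))).
    - refine (Cmod_RInt_le f _ _ _ _ _ Hc _ (CInt_correct f _ _ Cf) J).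
      intros x Hx. unfold f. rewrite Cmod_mult, Cmod_Cexp.
      replace (Re (- (s * x))%C) with (- Re s * x) by (unfold Re; simpl; ring).
      rewrite <- (Rmult_1_l (exp _)) at 2. apply Rmult_le_compat_r; auto. left; apply exp_pos.
    - unfold minus, plus, opp; simpl.
      assert (E1 := exp_pos (- Re s * c)).
      assert (E2 : exp (- Re s * b N) <= / (Re s * b N)).
      { replace (- Re s * b N) with (- (Re s * b N)) by ring. rewrite exp_Ropp.
        assert (0 < Re s * b N) by nra.
        apply Rinv_le_contravar; auto. apply le_exp. }
      assert (P : 0 < / Re s) by now apply Rinv_0_lt_compat.
      replace (/ (Re s * Re s * b N)) with (/ (Re s * b N) * / Re s) by (field; lra).
      rewrite Rinv_opp. nra. }
  assert (L : filterlim (fun c => CInt f 0 c) (Rbar_locally p_infty) (@locally C_R_NormedModule l)).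
  { apply (@filterlim_locally_ball_norm R_AbsRing R C_R_NormedModule); [typeclasses eauto|].
    intros [e He].
    assert (HG' := proj1 (@filterlim_locally_ball_norm R_AbsRing nat C_R_NormedModule eventually _ _ l) HG).
    assert (He2 : 0 < e / 2) by lra.
    destruct (HG' (mkposreal _ He2)) as [N0 HN0].
    assert (S2 : 0 < Re s * Re s) by nra.
    destruct (INR_unbounded (/ (Re s * Re s * (e / 2)))) as [N1 HN1].
    (* Beyond [N0] the series is within [e/2] of [l]; beyond [N1] the tail bound is below [e/2],
       because [b N >= N]. *)
    set (N := S (max N0 N1)).
    assert (bN : INR N1 < b N /\ 0 < b N).
    { assert (INR N1 < INR N) by (apply lt_INR; unfold N; lia). generalize (Hb N) (pos_INR N1); lra. }
    exists (b N). intros c Hc.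
    assert (B1 := HN0 N ltac:(unfold N; lia)). unfold ball_norm in B1 |- *.
    match type of B1 with norm ?u < _ => change (@norm R_AbsRing C_R_NormedModule u < e / 2) in B1 end.
    rewrite norm_Cmod in B1 |- *. change (@minus C_R_NormedModule) with Cminus in *.
    change (@minus (NormedModule.AbelianGroup R_AbsRing C_R_NormedModule)) with Cminus in *.
    rewrite <- IN in B1.
    assert (B2 := Tail N c ltac:(lra) (proj2 bN)).
    assert (B3 : / (Re s * Re s * b N) < e / 2).
    { assert (0 < / (Re s * Re s * (e / 2))) by (apply Rinv_0_lt_compat; nra).
      rewrite <- (Rinv_inv (e / 2)). apply Rinv_lt_contravar.
      - apply Rmult_lt_0_compat; [apply Rinv_0_lt_compat; lra|nra].
      - replace (/ (e / 2)) with (Re s * Re s * / (Re s * Re s * (e / 2))) by (field; lra).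
        apply Rmult_lt_compat_l; lra. }
    simpl pos. replace (CInt f 0 c - l)%C with ((CInt f 0 c - CInt f 0 (b N)) + (CInt f 0 (b N) - l))%C by ring.
    apply Rle_lt_trans with (1 := Cmod_triangle _ _). lra. }
  intros P HP. specialize (L P HP).
  (* The filter at the lower end is the point 0 itself, so only the upper limit moves. *)
  apply (Filter_prod _ _ _ (fun a => a = 0) (fun c => P (CInt f 0 c))); [reflexivity|exact L|].
  intros a c -> Hc. exists (CInt f 0 c). split; auto. simpl. now apply CInt_correct.
Qed.

(** * Choice of the scales [k n] and summability of the transforms *)

(** Doubling keeps the supports [2 pi k, 4 pi k] from overlapping. Since [k n >= 2], the power
    [k n - 1] of the sine is still positive, so the derivative of a bump vanishes at the ends of its
    support too. *)
Lemma sparse_sequence (rho : R -> R) (a : nat -> R) :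
  is_lim rho p_infty 0 -> (forall n, 0 < a n) ->
  exists k : nat -> nat, (forall n, (n + 2 <= k n)%nat) /\
    (forall n, (2 * k n <= k (S n))%nat) /\
    (forall n, rho (3 * PI * INR (k n)) < a n).
Proof.
  intros Hrho Ha.
  assert (X : forall n, exists K : nat, forall k, (K <= k)%nat -> rho (3 * PI * INR k) < a n).
  { intros n. apply is_lim_spec in Hrho. destruct (Hrho (mkposreal _ (Ha n))) as [M HM]. simpl in HM.
    destruct (INR_unbounded M) as [K HK]. exists K. intros k Hk.
    apply le_INR in Hk. assert (P := PI2_1). assert (K0 := pos_INR k).
    assert (B := HM (3 * PI * INR k) ltac:(nra)). apply Rabs_def2 in B. lra. }
  apply functional_choice in X. destruct X as [K HK].
  set (k := fix k n := match n with O => (K 0 + 2)%nat | S m => (2 * k m + K (S m))%nat end).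
  assert (k2 : forall n, (n + 2 <= k n)%nat) by (induction n as [|n IH]; simpl; lia).
  exists k. repeat split; auto.
  - intros n; simpl; lia.
  - intros n. apply HK. destruct n; simpl; lia.
Qed.

Lemma exp_mult_INR (x : R) (n : nat) : exp (x * INR n) = exp x ^ n.
Proof.
  induction n as [|n IH]; [now rewrite Rmult_0_r, exp_0|].
  rewrite S_INR, Rmult_plus_distr_l, exp_plus, IH, Rmult_1_r. simpl; ring.
Qed.

Lemma taylor_bound_scal (r M : R) (a : C) (G dG : C -> C) :
  Cmod a <= 1 -> taylor_bound r M G dG -> taylor_bound r M (fun s => a * G s)%C (fun s => a * dG s)%C.
Proof.
  intros Ha B s h Hs Hsh Hh. destruct (B s h Hs Hsh Hh) as (B1 & B2 & B3 & B4).
  assert (Q : forall u X, Cmod u <= X -> Cmod (a * u)%C <= X).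
  { intros u X Hu. rewrite Cmod_mult. generalize (Cmod_ge_0 u) (Cmod_ge_0 a). intros. nra. }
  repeat split; auto.
  - replace (a * G (s + h) - a * G s)%C with (a * (G (s + h) - G s))%C by ring. auto.
  - replace (a * G (s + h) - a * G s - h * (a * dG s))%C with (a * (G (s + h) - G s - h * dG s))%C by ring. auto.
Qed.

(** Once [n - r >= 2 exp A], the bound [(exp A / (n - r))^(k n)] is at most [2^-(k n)], hence at
    most [2^-n], however fast [k] grows. *)
Lemma wave_summable (k : nat -> nat) (a : nat -> C) (r : R) :
  (forall n, (n < k n)%nat) -> (forall n, Cmod (a n) <= 1) ->
  exists c : nat -> R, ex_series c /\
    forall n, taylor_bound r (c n) (fun s => a n * wave_Lap n (k n) (k n) s)%C
      (fun s => a n * wave_dLap n (k n) (k n) s)%C.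
Proof.
  intros Hk Ha.
  set (A := (r + 4) * (4 * PI)).
  (* For the finitely many [n < r + 2] the points [i (n + j/k)] may lie in or near the disc, and the
     trivial bound is kept. *)
  exists (fun n => if Rle_dec (r + 2) (INR n) then (exp A / (INR n - r)) ^ k n else exp (A * INR (k n))).
  split.
  - destruct (INR_unbounded (r + 2 + 2 * exp A)) as [N HN].
    apply (ex_series_incr_n _ N).
    apply (@ex_series_le R_AbsRing R_CompleteNormedModule _ (fun n => (/ 2) ^ n));
      [|apply ex_series_geom; rewrite Rabs_pos_eq; lra].
    intros n. assert (HNn : INR N <= INR (N + n)) by (apply le_INR; lia).
    assert (E := exp_pos A).
    destruct Rle_dec as [D|D]; [|exfalso; lra].
    change norm with Rabs.
    assert (Q : 0 <= exp A / (INR (N + n) - r) <= / 2).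
    { split; [apply Rdiv_le_0_compat; lra|]. apply Rmult_le_reg_r with (INR (N + n) - r); [lra|].
      unfold Rdiv. rewrite Rmult_assoc, Rinv_l; lra. }
    rewrite Rabs_pos_eq by (apply pow_le; lra).
    apply Rle_trans with ((/ 2) ^ k (N + n)%nat); [now apply pow_incr|].
    rewrite 2!pow_inv. apply Rinv_le_contravar; [apply pow_lt; lra|].
    apply Rle_pow; [lra|]. generalize (Hk (N + n)%nat); lia.
  - intros n. assert (Hkn := Hk n). assert (Hk0 : k n <> 0%nat) by lia.
    apply taylor_bound_scal; auto.
    destruct Rle_dec as [D|D].
    + unfold Rdiv. rewrite Rpow_mult_distr, pow_inv, <- exp_mult_INR.
      replace (A * INR (k n)) with ((r + 4) * (4 * PI * INR (k n))) by (unfold A; ring).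
      now apply wave_taylor_bound.
    + replace (A * INR (k n)) with ((r + 4) * (4 * PI * INR (k n))) by (unfold A; ring).
      assert (Hk' : 0 < INR (k n)) by (apply lt_0_INR; lia). assert (HPI := PI_RGT_0).
      assert (PK : 0 < PI * INR (k n)) by nra.
      apply Lap_taylor_bound; try lra.
      * intros x. now apply continuous_wave.
      * apply Cmod_wave_le.
Qed.

(** * The upper limit and the construction of [tau] *)

(** Every tail has supremum [p_infty], so the greatest lower bound is taken over the single value
    [p_infty]. *)
Lemma LimSup_infty_p_infty (g : R -> R) :
  (forall M X, exists x, X <= x /\ M <= g x) -> LimSup_infty g = p_infty.
Proof.
  intros H.
  assert (L : forall X, Lub_Rbar (fun y => exists x, X <= x /\ y = g x) = p_infty).
  { intros X. apply is_lub_Rbar_unique. split; [intros y _; exact I|].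
    intros b Hb. destruct b as [b| |]; simpl; auto.
    - destruct (H (b + 1) X) as (x & Hx & Hg). assert (B := Hb (g x) (ex_intro _ x (conj Hx eq_refl))).
      simpl in B. lra.
    - destruct (H 0 X) as (x & Hx & Hg). exact (Hb (g x) (ex_intro _ x (conj Hx eq_refl))). }
  apply Rbar_is_glb_unique. split.
  - intros y (X & _ & ->). rewrite L. exact I.
  - intros b Hb. apply (Hb p_infty). exists 0. split; [lra|]. symmetry; apply L.
Qed.

Lemma locally_nonneg_le (x : R) : filter_le (locally_nonneg x) (locally x).
Proof. apply filter_le_within. Qed.

Lemma locally_nonneg_proper (x : R) : 0 <= x -> ProperFilter (locally_nonneg x).
Proof.
  intros Hx. apply Build_ProperFilter; [|apply within_filter, locally_filter].
  intros P [e He]. exists x. apply He; auto. apply ball_center.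
Qed.

Theorem theorem1p2 (rho : R -> R)
  (rho_pos : forall x : R, 0 <= x -> 0 < rho x)
  (rho_lim : is_lim rho p_infty 0) :
  exists tau : R -> C,
    V_minus_infty tau /\
    LimSup_infty (fun x : R => Cmod (tau x) / rho x) = p_infty.
Proof.
  (* One power of [n + 2] pays for the bound on [dwave], the other makes the derivative tend to
     0. *)
  set (amp := fun n => / (INR n + 2) ^ 2).
  assert (amp_pos : forall n, 0 < amp n).
  { intros n. apply Rinv_0_lt_compat, pow_lt. generalize (pos_INR n); lra. }
  assert (amp_le : forall n, amp n * (INR n + 2) <= / (INR n + 1)).
  { intros n. assert (n0 := pos_INR n). unfold amp.
    replace (/ (INR n + 2) ^ 2 * (INR n + 2)) with (/ (INR n + 2)) by (field; lra).
    apply Rinv_le_contravar; lra. }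
  assert (amp_1 : forall n, amp n <= 1).
  { intros n. assert (n0 := pos_INR n). assert (A := amp_le n). assert (B := amp_pos n).
    assert (/ (INR n + 1) <= 1) by (rewrite <- Rinv_1; apply Rinv_le_contravar; lra). nra. }
  (* The extra divisor [n + 1] is what makes the ratio to [rho] unbounded. *)
  destruct (sparse_sequence rho (fun n => amp n / (INR n + 1)) rho_lim) as (k & Hk & k2 & Hrho).
  { intros n. apply Rdiv_lt_0_compat; auto. generalize (pos_INR n); lra. }
  assert (Hk0 : forall n, k n <> 0%nat) by (intros n; generalize (Hk n); lia).
  assert (HPI := PI_RGT_0). assert (HPI2 := PI2_1).
  set (X := fun n => 2 * PI * INR (k n)). set (Y := fun n => 4 * PI * INR (k n)).
  assert (X_ge : forall n, INR n <= X n).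
  { intros n. assert (A := le_INR _ _ (Hk n)). rewrite plus_INR in A. simpl in A. unfold X.
    assert (n0 := pos_INR n). nra. }
  assert (XY : forall n, X n < Y n).
  { intros n. generalize (X_ge n) (pos_INR n) (lt_0_INR (k n) ltac:(generalize (Hk n); lia)).
    unfold X, Y. intros. nra. }
  assert (YX : forall m n, (m < n)%nat -> Y m <= X n).
  { intros m n Hmn.
    assert (D : (2 * k m <= k n)%nat).
    { induction Hmn as [|n Hmn IH]; [apply k2|]. generalize (k2 n); lia. }
    apply le_INR in D. rewrite mult_INR in D. simpl (INR 2) in D. unfold X, Y. nra. }
  set (f := fun n x => (amp n * wave n (k n) (k n) x)%C).
  set (df := fun n x => (amp n * dwave n (k n) (k n) x)%C).
  assert (f_ends : forall n, f n (X n) = 0%C /\ f n (Y n) = 0%C).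
  { intros n. unfold f, X, Y. destruct (wave_ends n (k n) (k n)) as [-> ->]; auto. split; ring. }
  assert (df_ends : forall n, df n (X n) = 0%C /\ df n (Y n) = 0%C).
  { intros n. unfold df, dwave, X, Y. destruct (wave_ends n (k n) (k n)) as [-> ->]; auto.
    destruct (wave_ends n (k n) (pred (k n))) as [-> ->]; auto; [generalize (Hk n); lia|]. split; ring. }
  set (g := fun n => clamp (X n) (Y n) (f n)). set (dg := fun n => clamp (X n) (Y n) (df n)).
  assert (g_out : forall n x, x <= X n \/ Y n <= x -> g n x = 0%C).
  { intros n x Hx. apply clamp_out; auto; try apply f_ends. now apply Rlt_le. }
  assert (dg_out : forall n x, x <= X n \/ Y n <= x -> dg n x = 0%C).
  { intros n x Hx. apply clamp_out; auto; try apply df_ends. now apply Rlt_le. }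
  assert (Hg : locally_finite g).
  { intros n x Hx. apply g_out. left. apply Rle_trans with (1 := Hx); auto. }
  assert (Hdg : locally_finite dg).
  { intros n x Hx. apply dg_out. left. apply Rle_trans with (1 := Hx); auto. }
  assert (Df : forall n x, @is_derive R_AbsRing C_R_NormedModule (f n) x (df n x)).
  { intros n x. assert (D := is_derive_Cmult _ _ x _ _
      (@is_derive_const R_AbsRing C_R_NormedModule (RtoC (amp n)) x) (is_derive_wave n (k n) (k n) x (Hk0 n))).
    refine (eq_rect _ (@is_derive R_AbsRing C_R_NormedModule _ x) D _ _).
    unfold df. change (@zero C_R_NormedModule) with (RtoC 0). Ceq; ring. }
  assert (Cf : forall n x, continuous (f n) x).
  { intros n x. exact (is_derive_continuous_C _ _ _ (Df n x)). }
  assert (Cdf : forall n x, continuous (df n) x).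
  { intros n x. apply continuous_Cmult; [apply continuous_const|now apply continuous_dwave]. }
  (* At most one bump is alive at [x]; if there is none, all terms vanish and any index serves. *)
  assert (single : forall x, exists n, total g x = g n x /\ total dg x = dg n x).
  { intros x. destruct (classic (exists n, X n < x < Y n)) as [[n Hn]|Hn].
    - exists n. assert (O : forall m, m <> n -> x <= X m \/ Y m <= x).
      { intros m Hm. destruct (Nat.lt_gt_cases m n) as [H _]. destruct (H Hm) as [L|L]; apply YX in L; lra. }
      split; apply total_single; auto.
    - assert (O : forall m, x <= X m \/ Y m <= x).
      { intros m. destruct (Rle_dec x (X m)); auto. destruct (Rle_dec (Y m) x); auto.
        exfalso; apply Hn; exists m; lra. }
      exists 0%nat. split; apply total_single; auto. }
  assert (Bg : forall n x, Cmod (g n x) <= 1).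
  { intros n x. unfold g, clamp, f. rewrite Cmod_mult, Cmod_R, Rabs_pos_eq by (left; auto).
    assert (W := Cmod_wave_le n (k n) (k n) (Rmax (X n) (Rmin x (Y n)))).
    generalize (amp_1 n) (amp_pos n) (Cmod_ge_0 (wave n (k n) (k n) (Rmax (X n) (Rmin x (Y n))))). intros. nra. }
  assert (Bdg : forall n x, Cmod (dg n x) <= / (INR n + 1)).
  { intros n x. apply Rle_trans with (2 := amp_le n).
    unfold dg, clamp, df. rewrite Cmod_mult, Cmod_R, Rabs_pos_eq by (left; auto).
    apply Rmult_le_compat_l; [left; auto|]. now apply Cmod_dwave_le. }
  exists (total g). split; [split|].
  - exists (total dg). split; [|split].
    (* [total g] is differentiable on all of [R], and the notion relative to [0, oo) follows by
       refining the filter. *)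
    + intros x Hx. apply (@filterdiff_locally R_AbsRing R_NormedModule C_R_NormedModule _
         (locally_nonneg_proper x Hx) _ x).
      * apply locally_nonneg_le.
      * apply is_derive_total; auto. intros n.
        apply is_derive_clamp; auto; first [apply f_ends|apply df_ends].
    + intros x Hx. apply (filterlim_filter_le_1 _ (locally_nonneg_le x)).
      apply continuous_total; auto. intros n. apply continuous_clamp; auto.
    + apply (@filterlim_locally_ball_norm R_AbsRing R C_R_NormedModule); [typeclasses eauto|].
      intros [e He]. destruct (INR_unbounded (/ e)) as [N HN].
      (* Beyond [Y N] the bumps up to index [N] are over, and a later one has slope at most
         [1/(n + 1) < e]. *)
      exists (Y N). intros x Hx. destruct (single x) as (n & _ & ->).
      unfold ball_norm. refine (Rle_lt_trans _ _ _ (Req_le _ _ (norm_Cmod _)) _).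
      change (@minus (NormedModule.AbelianGroup R_AbsRing C_R_NormedModule)) with Cminus.
      replace (dg n x - 0)%C with (dg n x) by ring. simpl.
      destruct (Nat.le_gt_cases n N) as [L|L].
      * rewrite dg_out, Cmod_0; auto. right.
        destruct (proj1 (Nat.lt_eq_cases n N) L) as [L'| ->]; [|lra].
        generalize (YX _ _ L') (XY N); lra.
      * apply Rle_lt_trans with (1 := Bdg n x). apply lt_INR in L.
        assert (0 < / e) by now apply Rinv_0_lt_compat.
        rewrite <- (Rinv_inv e). apply Rinv_lt_contravar; [apply Rmult_lt_0_compat|]; lra.
  - destruct (entire_series (fun n s => amp n * wave_Lap n (k n) (k n) s)%C
      (fun n s => amp n * wave_dLap n (k n) (k n) s)%C) as (F & HF & SF).
    { intros r. apply wave_summable.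
      - intros n; generalize (Hk n); lia.
      - intros n. rewrite Cmod_R, Rabs_pos_eq; auto. now left. }
    exists F. split; auto. intros s Hs.
    apply (is_Laplace_of_series g Y (fun n => amp n * wave_Lap n (k n) (k n) s)%C); auto.
    + intros n x. apply continuous_clamp; auto.
    + intros x. destruct (single x) as (n & -> & _). auto.
    + intros n. generalize (X_ge n) (XY n); lra.
    + intros N n Hn x Hx. apply g_out. left. generalize (YX N n Hn); lra.
    + intros N n Hn. apply is_RInt_clamp; auto; try apply f_ends.
      * generalize (X_ge n) (pos_INR n); lra.
      * destruct (proj1 (Nat.lt_eq_cases n N) Hn) as [L'| ->]; [|lra].
        generalize (YX _ _ L') (XY N); lra.
      * refine (is_RInt_ext _ _ _ _ _ _ (is_RInt_Cmult _ _ _ (RtoC (amp n)) _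
          (Lap_correct (wave n (k n) (k n)) (X n) (Y n) s _))).
        -- intros x _. unfold f. Ceq; ring.
        -- intros x. now apply continuous_wave.
  - apply LimSup_infty_p_infty. intros M X0.
    destruct (INR_unbounded (Rmax M X0)) as [n Hn].
    (* The midpoint of the support, where [x/2k = 3 pi/2] and the sine has modulus 1. *)
    set (x := 3 * PI * INR (k n)).
    assert (kn : INR n + 2 <= INR (k n)).
    { assert (A := le_INR _ _ (Hk n)). rewrite plus_INR in A. simpl in A. lra. }
    assert (n0 := pos_INR n).
    assert (x_in : X n < x < Y n) by (unfold X, Y, x; nra).
    assert (x_ge : INR n <= x) by (generalize (X_ge n); lra).
    exists x. split; [generalize (Rmax_r M X0); lra|].
    apply Rle_trans with (INR n + 1); [generalize (Rmax_l M X0); lra|].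
    rewrite (total_single g x n Hg).
    2:{ intros m Hm. apply g_out. destruct (Nat.lt_gt_cases m n) as [H _].
        destruct (H Hm) as [L|L]; apply YX in L; lra. }
    unfold g. rewrite clamp_in by lra. unfold f.
    rewrite Cmod_mult, Cmod_R, Rabs_pos_eq, Cmod_wave by (left; auto).
    replace (x / (2 * INR (k n))) with (3 * (PI / 2)) by (unfold x; field; lra).
    rewrite <- RPow_abs, sin_3PI2, Rabs_m1, pow1, Rmult_1_r.
    assert (rp := rho_pos x ltac:(lra)). assert (rl := Hrho n). fold x in rl.
    apply Rmult_le_reg_r with (rho x); auto.
    unfold Rdiv. rewrite Rmult_assoc, Rinv_l, Rmult_1_r by lra.
    apply Rmult_le_reg_r with (/ (INR n + 1)); [apply Rinv_0_lt_compat; lra|].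
    replace ((INR n + 1) * rho x * / (INR n + 1)) with (rho x) by (field; lra).
    left. exact rl.
Qed.
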